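(* Let $G$ be a finite graph on the vertex set $\{x_1,\ldots,x_n\}$ with no loops, no multiple edges and no isolated vertices, and for $q\geq 1$ let $\mathcal{G}(I(G)^q)$ denote the minimal set of monomial generators of $I(G)^q$. The following conditions are equivalent: (i) $\mathcal{G}(I(G)^q)$ is a polymatroid for some $q\geq 1$; (ii) $\mathcal{G}(I(G)^q)$ is a polymatroid for all $q\geq 1$; (iii) $G$ is a complete multipartite graph. Furthermore, if $G$ is a complete multipartite graph, then for all $q\geq 1$ the toric ideal $J_{\mathcal{G}(I(G)^q)}$ of $\mathcal{G}(I(G)^q)$ is generated by symmetric exchange binomials.
   Context: Let $S=K[x_1,\ldots,x_n]$ be a polynomial ring over a field $K$. A finite set $\mathcal{B}$ of monomials of $S$ is called a polymatroid if (i) all elements of $\mathcal{B}$ have the same degree and (ii) whenever $u=x_1^{a_1}\cdots x_n^{a_n}$ and $v=x_1^{b_1}\cdots x_n^{b_n}$ belong to $\mathcal{B}$ with $a_\xi>b_\xi$, there is $\rho$ with $a_\rho<b_\rho$ such that $x_\rho u/x_\xi\in\mathcal{B}$. The edge ideal $I(G)$ is the ideal of $S$ generated by the monomials $x_ix_j$ with $\{x_i,x_j\}$ an edge of $G$. For a finite set of monomials $\mathcal{B}=\{w_1,\ldots,w_s\}$, let $T=K[z_1,\ldots,z_s]$ and $\pi:T\to K[w_1,\ldots,w_s]$ be the $K$-algebra homomorphism with $\pi(z_i)=w_i$; the toric ideal of $\mathcal{B}$ is $J_{\mathcal{B}}=\ker\pi$. A symmetric exchange binomial of $\mathcal{B}$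 is a binomial $z_iz_j-z_{i_0}z_{j_0}$ where $w_i=x_1^{a_1}\cdots x_n^{a_n}$, $w_j=x_1^{b_1}\cdots x_n^{b_n}$, and there are indices $\xi,\rho$ with $a_\xi>b_\xi$, $a_\rho<b_\rho$ such that $w_{i_0}=x_\rho w_i/x_\xi$ and $w_{j_0}=x_\xi w_j/x_\rho$ both belong to $\mathcal{B}$. A complete multipartite graph is a graph whose vertex set is partitioned into $m\geq 2$ nonempty parts $V_1,\ldots,V_m$, with edges exactly the pairs $\{x,y\}$ with $x,y$ in different parts. *)

(* Defs.v *)
From HB Require Import structures.
From mathcomp Require Import all_boot all_order all_algebra.
From mathcomp Require Import mpoly.
Set Implicit Arguments. Unset Strict Implicit. Unset Printing Implicit Defensive.
Import GRing.Theory.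
Local Open Scope ring_scope.

Definition mon (n : nat) := 'X_{1..n}.

Definition edge_mon n (i j : 'I_n) : mon n := (U_(i) + U_(j))%MM.

Definition edges_prod n (t : seq ('I_n * 'I_n)) : mon n :=
  foldr (fun p acc => (edge_mon p.1 p.2 + acc)%MM) 0%MM t.

Definition in_edge_ideal_pow n (e : rel 'I_n) (q : nat) (u : mon n) : Prop :=
  exists t : seq ('I_n * 'I_n),
    [/\ size t = q, (forall p, p \in t -> e p.1 p.2) & (edges_prod t <= u)%MM].

(* The minimal set of monomial generators G(I) of a monomial ideal I, given by
   the set of its monomials: the monomials of I not properly divisible by
   another monomial of I. *)
Definition min_gens n (I : mon n -> Prop) (u : mon n) : Prop :=
  I u /\ (forall v, I v -> (v <= u)%MM -> v = u).

(* Polymatroid: a finite set of monomials of the same degree with the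
   exchange property. "x_rho u / x_xi = w" is written w * x_xi = u * x_rho. *)
Definition polymatroid n (B : mon n -> Prop) : Prop :=
  [/\ (exists s : seq (mon n), forall u, B u <-> u \in s),
      (forall u v, B u -> B v -> mdeg u = mdeg v) &
      (forall u v (xi : 'I_n), B u -> B v -> v xi < u xi ->
         exists rho : 'I_n, u rho < v rho /\
           exists w, B w /\ (w + U_(xi) = u + U_(rho))%MM)]%N.

Definition complete_multipartite n (e : rel 'I_n) : Prop :=
  exists m : nat, (2 <= m)%N /\
    exists p : 'I_n -> 'I_m,
      (forall k : 'I_m, exists i, p i = k) /\ (forall i j, e i j = (p i != p j)).

Definition toric_map (K : fieldType) n s (w : s.-tuple (mon n))
  (f : {mpoly K[s]}) : {mpoly K[n]} :=
  f \mPo [tuple 'X_[tnth w i] | i < s].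

Definition sym_exch_binomial (K : fieldType) n s (w : s.-tuple (mon n))
  (f : {mpoly K[s]}) : Prop :=
  exists (i j i0 j0 : 'I_s) (xi rho : 'I_n),
    [/\ (tnth w j xi < tnth w i xi)%N, (tnth w i rho < tnth w j rho)%N,
        (tnth w i0 + U_(xi) = tnth w i + U_(rho))%MM,
        (tnth w j0 + U_(rho) = tnth w j + U_(xi))%MM &
        f = 'X_i * 'X_j - 'X_i0 * 'X_j0].

Definition in_ideal_gen (R : comRingType) (P : R -> Prop) (f : R) : Prop :=
  exists r : seq (R * R), (forall x, x \in r -> P x.2) /\
                          f = \sum_(x <- r) x.1 * x.2.

Definition toric_generated_by_sym_exch (K : fieldType) n s
  (w : s.-tuple (mon n)) : Prop :=
  forall f : {mpoly K[s]},
    toric_map w f = 0 <-> in_ideal_gen (@sym_exch_binomial K n s w) f.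

(* Main.v *)
(* Since all products of q edges have degree 2q, they are exactly the minimal
   generators of I(G)^q. For a complete multipartite graph they are the monomials
   of degree 2q whose degree in each part is at most q, and these satisfy a
   symmetric exchange property. Conversely, if ij is an edge and k is adjacent to
   neither i nor j, let l be a neighbour of k: exchanging l in (x_k x_l)^q towards
   (x_i x_j)^q forces x_k^q x_l^(q-1) x_i or x_k^q x_l^(q-1) x_j to be a product of
   q edges, which makes k adjacent to i or j. So non-adjacency is an equivalence.

   For the toric ideal, any move (u, v) -> (u x_rho / x_xi, v x_xi / x_rho) inside
   the set of generators, even one that is not a symmetric exchange, is a
   composite of symmetric exchanges and their inverses. Such moves connect any two
   words of generators with the same product: they turn the first letter of one
   word into the first letter of the other, and one inducts on the length. *)
Require Import Defs.
From HB Require Import structures.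
From mathcomp Require Import all_boot all_order all_algebra.
From mathcomp Require Import mpoly.
From mathcomp Require Import zify.
Set Implicit Arguments.
Unset Strict Implicit.
Unset Printing Implicit Defensive.

(** * Minimal generators of powers of an edge ideal *)

Lemma mdeg_edges_prod n (t : seq ('I_n * 'I_n)) :
  mdeg (edges_prod t) = (size t).*2.
Proof.
elim: t => [|x t IHt] /=; first by rewrite mdeg0.
by rewrite mdegD mdegD !mdeg1 IHt.
Qed.

Lemma lem_mdeg_eq n (u v : mon n) : (u <= v)%MM -> mdeg u = mdeg v -> u = v.
Proof.
move=> le_uv dE; have /eqP : mdeg (v - u)%MM = 0.
  by have := congr1 (@mdeg n) (submK le_uv); rewrite mdegD dE; lia.
by rewrite mdeg_eq0 => /eqP vu0; rewrite -(submK le_uv) vu0 add0m.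
Qed.

(** A monomial lying between two products of [q] edges has degree [q.*2], like both of them, so all
    three coincide. *)
Lemma min_gensP n (e : rel 'I_n) q u :
  min_gens (in_edge_ideal_pow e q) u <->
  exists t, [/\ size t = q, forall x, x \in t -> e x.1 x.2 & edges_prod t = u].
Proof.
split=> [[[t [st et le_tu]] min_u]|[t [st et <-]]].
  exists t; split=> //; apply: min_u => //.
  by exists t; split=> //; apply: lepm_refl.
split=> [|v [t' [st' et' le_t'v]] le_vt].
  by exists t; split=> //; apply: lepm_refl.
have eq_t't : edges_prod t' = edges_prod t.
  by apply: lem_mdeg_eq; rewrite ?mdeg_edges_prod ?st ?st' //;
     apply: lepm_trans le_vt.
apply: lem_mdeg_eq => //.
have := submK le_vt; have := submK le_t'v => <- /(congr1 (@mdeg n)).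
by rewrite !mdegD eq_t't; lia.
Qed.

(** * Exchange moves, degrees in the parts, and symmetric exchange *)

Lemma mdeg_exch n (u u' : mon n) xi rho :
  (u' + U_(xi))%MM = (u + U_(rho))%MM -> mdeg u' = mdeg u.
Proof. by move/(congr1 (@mdeg n)); rewrite !mdegD !mdeg1; lia. Qed.

Lemma mnm_exchE n (u u' : mon n) xi rho :
  (u' + U_(xi))%MM = (u + U_(rho))%MM ->
  forall i, u' i + (xi == i) = u i + (rho == i).
Proof. by move=> uE i; rewrite -!mnm1E -!mnmDE uE. Qed.

Lemma mnm_exch_ex n (u : mon n) xi rho : 0 < u xi ->
  exists u' : mon n, (u' + U_(xi) = u + U_(rho))%MM.
Proof.
move=> u_xi; exists (u - U_(xi) + U_(rho))%MM.
apply/mnmP => i; rewrite !(mnmDE, mnmBE, mnm1E).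
by case: eqP => [<-|_] /=; lia.
Qed.

(** The degree of [u] in the variables of part [k]; the map [p] sends each vertex to its part. *)
Definition psum n m (p : 'I_n -> 'I_m) (u : mon n) k := \sum_(i | p i == k) u i.

Lemma psumD n m (p : 'I_n -> 'I_m) u v k :
  psum p (u + v)%MM k = psum p u k + psum p v k.
Proof. by rewrite -big_split /=; apply: eq_bigr => i _; rewrite mnmDE. Qed.

Lemma psum1 n m (p : 'I_n -> 'I_m) i k : psum p U_(i)%MM k = (p i == k).
Proof.
rewrite /psum; under eq_bigr do rewrite mnm1E.
case: eqP => [pi|npi]; first by
  rewrite (bigD1 i) /= ?pi // eqxx big1 // => j /andP[_ /negPf]; rewrite eq_sym => ->.
by rewrite big1 // => j /eqP pj; case: eqP => // ij; rewrite -ij in pj.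
Qed.

Lemma psum_exch n m (p : 'I_n -> 'I_m) (u u' : mon n) xi rho k :
  (u' + U_(xi))%MM = (u + U_(rho))%MM ->
  psum p u' k + (p xi == k) = psum p u k + (p rho == k).
Proof. by move=> uE; rewrite -!psum1 -!psumD uE. Qed.

Lemma mdeg_psum n m (p : 'I_n -> 'I_m) u : mdeg u = \sum_k psum p u k.
Proof. by rewrite mdegE (partition_big p xpredT). Qed.

Lemma psum_gt0 n m (p : 'I_n -> 'I_m) (u : mon n) k :
  0 < psum p u k -> exists i, p i = k /\ 0 < u i.
Proof.
move=> u_k; suff /existsP[i /andP[/eqP]] : [exists i, (p i == k) && (0 < u i)].
  by exists i.
apply: contraTT u_k => /existsPn ni; rewrite -eqn0Ngt /psum big1 // => i pi.
by have := ni i; rewrite pi /= -eqn0Ngt => /eqP.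
Qed.

Lemma psum_lt n m (p : 'I_n -> 'I_m) (u v : mon n) k :
  psum p u k < psum p v k -> exists i, p i = k /\ u i < v i.
Proof.
move=> uv_k; suff /existsP[i /andP[/eqP]] : [exists i, (p i == k) && (u i < v i)].
  by exists i.
apply: contraTT uv_k => /existsPn ni; rewrite -leqNgt; apply: leq_sum => i pi.
by have := ni i; rewrite pi /= -leqNgt.
Qed.

Lemma mdeg_psum_lt n m (p : 'I_n -> 'I_m) (u v : mon n) k :
  mdeg u = mdeg v -> psum p v k < psum p u k ->
  exists l, psum p u l < psum p v l.
Proof.
rewrite !(mdeg_psum p) => dE uv_k.
suff /existsP[l] : [exists l, psum p u l < psum p v l] by exists l.
apply: contraT => /existsPn nl.
have : \sum_k psum p v k < \sum_k psum p u k.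
  rewrite (bigD1 k) //= [ltnRHS](bigD1 k) //= -addSn leq_add //.
  by apply: leq_sum => l _; rewrite leqNgt nl.
by rewrite dE ltnn.
Qed.

(** An explicit description of the generators when the parts are the fibres of [p]; boolean, so that
    it can filter a finite enumeration. *)
Definition part_bounded n m (p : 'I_n -> 'I_m) q (u : mon n) :=
  (mdeg u == q.*2) && [forall k, psum p u k <= q].

Lemma part_boundedP n m (p : 'I_n -> 'I_m) q u :
  reflect (mdeg u = q.*2 /\ forall k, psum p u k <= q) (part_bounded p q u).
Proof.
by apply: (iffP andP) => [[/eqP ? /forallP ?]|[? ?]]; split=> //;
   [apply/eqP|apply/forallP].
Qed.

(** Only the part of [rho] can gain, and only by one, unless it also contains [xi]. *)
Lemma part_bounded_exch n m (p : 'I_n -> 'I_m) q (u u' : mon n) xi rho :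
  part_bounded p q u -> (u' + U_(xi))%MM = (u + U_(rho))%MM ->
  p rho = p xi \/ psum p u (p rho) < q -> part_bounded p q u'.
Proof.
move=> /part_boundedP[du uq] uE ok; apply/part_boundedP.
split=> [|k]; first by rewrite (mdeg_exch uE).
have := psum_exch p k uE; have := uq k.
case: (p rho =P k) ok => [<-|_]; last by lia.
by case=> [->|]; rewrite ?eqxx; lia.
Qed.

(** A [rho] in the part of [xi] leaves all part sums unchanged. Otherwise the strict inequalities
    between part sums leave room for [rho] in [u] and for [xi] in [v]. *)
Lemma part_bounded_sym_exch n m (p : 'I_n -> 'I_m) q (u v : mon n) xi :
  part_bounded p q u -> part_bounded p q v -> v xi < u xi ->
  exists rho, [/\ u rho < v rho,
    p rho = p xi \/ psum p v (p xi) < psum p u (p xi) /\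
                    psum p u (p rho) < psum p v (p rho) &
    exists u' v', [/\ part_bounded p q u', part_bounded p q v',
      (u' + U_(xi) = u + U_(rho))%MM & (v' + U_(rho) = v + U_(xi))%MM]].
Proof.
move=> uB vB vu_xi.
have [/part_boundedP[du uq] /part_boundedP[dv vq]] := (uB, vB).
suff [rho [uv_rho ok]] : exists rho, u rho < v rho /\
    (p rho = p xi \/ psum p v (p xi) < psum p u (p xi) /\
                    psum p u (p rho) < psum p v (p rho)).
  exists rho; split=> //.
  have [u' u'E] := @mnm_exch_ex n u xi rho ltac:(lia).
  have [v' v'E] := @mnm_exch_ex n v rho xi ltac:(lia).
  exists u', v'; split=> //.
    apply: part_bounded_exch uB u'E _; case: ok => [->|[_ lt]]; first by left.
    by right; apply: leq_trans lt (vq _).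
  apply: part_bounded_exch vB v'E _; case: ok => [->|[lt _]]; first by left.
  by right; apply: leq_trans lt (uq _).
case: (boolP [exists i, (p i == p xi) && (u i < v i)]) => [/existsP[i /andP[/eqP pi lt]]|].
  by exists i; split=> //; left.
move=> /existsPn ni.
(* No candidate in the part of [xi]: there [v] is below [u], strictly at [xi]. Equal total degrees
   then give another part where [u] is smaller. *)
have vu : psum p v (p xi) < psum p u (p xi).
  rewrite /psum (bigD1 xi) //= [ltnRHS](bigD1 xi) //= -addSn leq_add //.
  apply: leq_sum => i /andP[/eqP pi _].
  by have := ni i; rewrite pi eqxx /= -leqNgt.
have [l uv_l] := mdeg_psum_lt (etrans du (esym dv)) vu.
have [rho [prho lt]] := psum_lt uv_l.
by exists rho; split=> //; right; rewrite prho.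
Qed.

(** * Generators for a complete multipartite graph *)

Lemma psum_edges_prod n m (p : 'I_n -> 'I_m) t k :
  (forall x, x \in t -> p x.1 != p x.2) -> psum p (edges_prod t) k <= size t.
Proof.
elim: t => [|x t IHt] pt; first by rewrite /psum big1 // => i _; rewrite mnm0E.
rewrite /= psumD /edge_mon psumD !psum1.
have := pt x (mem_head _ _); have := IHt (fun y yt => pt y (mem_behead (s := x :: t) yt)).
by case: (p x.1 =P k) => [->|_]; case: (p x.2 =P k) => [->|_]; rewrite ?eqxx //= => le_t _; rewrite ?addn0 ?add0n ?add1n ?leqW.
Qed.

(* Splitting off an edge between the two parts with the largest sums keeps the
   other sums below q: three sums equal to q.+1 would exceed the degree. *)
Lemma part_bounded_edges n m (p : 'I_n -> 'I_m) q u :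
  part_bounded p q u ->
  exists t, [/\ size t = q, forall x, x \in t -> p x.1 != p x.2
              & edges_prod t = u].
Proof.
elim: q u => [|q IHq] u /part_boundedP[du uq].
  exists [::]; split=> //=; apply/esym/eqP.
  by rewrite -mdeg_eq0 du.
have := du; rewrite (mdeg_psum p) => su.
have [a0 _] : exists k, 0 < psum p u k.
  apply/existsP; apply: contraT => /existsPn n0; move: su; rewrite big1 // => k _.
  by apply/eqP; rewrite eqn0Ngt n0.
have [a _ amax] := @arg_maxnP _ a0 xpredT (psum p u) isT.
rewrite (bigD1 a) //= in su.
have sa := uq a.
have [b0 b0a] : exists k, k != a.
  suff /existsP : [exists k, k != a] by [].
  apply: contraT => /existsPn na; move: su; rewrite big1; first by lia.
  by move=> k ka; have := na k; rewrite ka.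
have [b ba bmax] := @arg_maxnP _ b0 (fun k => k != a) (psum p u) b0a.
(* Otherwise part [a] alone would carry the whole degree, twice its bound [q.+1]. *)
have b_gt0 : 0 < psum p u b.
  rewrite lt0n; apply/eqP => b0'; move: su; rewrite big1; first by lia.
  by move=> k /bmax /=; rewrite b0' leqn0 => /eqP.
have a_gt0 : 0 < psum p u a by apply: leq_trans b_gt0 (amax b _).
have [i [pi ui]] := psum_gt0 a_gt0; have [j [pj uj]] := psum_gt0 b_gt0.
have pij : p i != p j by rewrite pi pj eq_sym.
have le_ij : (edge_mon i j <= u)%MM.
  apply/mnm_lepP => k; rewrite /edge_mon mnmDE !mnm1E.
  case: (i =P k) => [ik|_]; case: (j =P k) => [jk|_] //=.
  - by rewrite ik jk eqxx in pij.
  - by rewrite -ik.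
  - by rewrite -jk.
have uE := submK le_ij.
have [] := IHq (u - edge_mon i j)%MM.
  apply/part_boundedP; split=> [|k].
    by move: du; rewrite -{1}uE mdegD mdegD !mdeg1; lia.
  have := uq k; have := congr1 (psum p ^~ k) uE.
  rewrite psumD /edge_mon psumD !psum1 pi pj.
  case: (a =P k) => [_|/eqP ak] /=; first by lia.
  case: (b =P k) => [_|/eqP bk] /=; first by lia.
  have ka : k != a by rewrite eq_sym.
  have := bmax k ka; have := amax b isT.
  move: su; rewrite (bigD1 b) //= (bigD1 k) /= ?ka 1?eq_sym //=; lia.
move=> t [st pt tE]; exists ((i, j) :: t); split=> /= [|x|].
- by rewrite st.
- by rewrite inE => /predU1P[->|/pt].
- by rewrite tE addmC.
Qed.

Lemma min_gens_multipartite n m (p : 'I_n -> 'I_m) (e : rel 'I_n) q u :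
  (forall i j, e i j = (p i != p j)) ->
  min_gens (in_edge_ideal_pow e q) u <-> part_bounded p q u.
Proof.
move=> eE; rewrite min_gensP; split=> [[t [st et <-]]|/part_bounded_edges[t [st pt tE]]].
  apply/part_boundedP; rewrite mdeg_edges_prod st; split=> // k.
  by rewrite -st psum_edges_prod // => x /et; rewrite eE.
by exists t; split=> // x /pt; rewrite eE.
Qed.

Lemma polymatroid_multipartite n m (p : 'I_n -> 'I_m) (e : rel 'I_n) q :
  (forall i j, e i j = (p i != p j)) ->
  polymatroid (min_gens (in_edge_ideal_pow e q)).
Proof.
move=> eE; have BE u := min_gens_multipartite q u eE.
split=> [|u v /BE/part_boundedP[-> _] /BE/part_boundedP[-> _] //|].
  (* Finiteness: all generators are among the finitely many monomials of degree below [q.*2.+1]. *)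
  exists [seq val u | u <- enum {: 'X_{1..n < q.*2.+1}} & part_bounded p q (val u)] => u.
  rewrite BE; split=> [uB|/mapP[v]]; last by rewrite mem_filter => /andP[vB _] ->.
  have du : mdeg u < q.*2.+1 by case/part_boundedP: uB => ->.
  by apply/mapP; exists (BMultinom du); rewrite // mem_filter uB mem_enum.
move=> u v xi /BE uB /BE vB vu_xi.
have [rho [uv_rho _ [u' [_ [u'B _ u'E _]]]]] := part_bounded_sym_exch uB vB vu_xi.
by exists rho; split=> //; exists u'; split=> //; apply/BE.
Qed.

(** * From the exchange property to complete multipartite graphs *)

Lemma edges_prod_le n (e : rel 'I_n) t k : irreflexive e ->
  (forall x, x \in t -> e x.1 x.2) -> edges_prod t k <= size t.
Proof.
move=> e_irr; elim: t => [|x t IHt] et /=; first by rewrite mnm0E.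
rewrite /edge_mon !mnmDE !mnm1E.
have := et x (mem_head _ _); have := IHt (fun y yt => et y (mem_behead (s := x :: t) yt)).
by case: (x.1 =P k) => [->|_]; case: (x.2 =P k) => [->|_]; rewrite ?e_irr //= => le_t _; rewrite ?addn0 ?add0n ?add1n ?leqW.
Qed.

(* Every edge contains k at most once, so exponent size t puts k in every edge. *)
Lemma edges_prod_neighbour n (e : rel 'I_n) t k r :
  ssrbool.symmetric e -> irreflexive e -> (forall x, x \in t -> e x.1 x.2) ->
  edges_prod t k = size t -> r != k -> 0 < edges_prod t r -> e k r.
Proof.
move=> e_sym e_irr; elim: t => [|x t IHt] et /=; first by rewrite !mnm0E.
have et' y (yt : y \in t) := et y (mem_behead (s := x :: t) yt).
have le_t := edges_prod_le k e_irr et'.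
have ex := et x (mem_head _ _).
rewrite /edge_mon !mnmDE !mnm1E => tk rk tr; rewrite eq_sym in rk.
(* If both ends of the head edge were [k] it would be a loop; if one is, [k] has full exponent in
   the tail; if none is, the tail would contain [k] more often than it has edges. *)
move: tk tr; case: (x.1 =P k) => [x1|_]; case: (x.2 =P k) => [x2|_] /=.
- by rewrite x1 x2 e_irr in ex.
- rewrite x1 (negPf rk) => -[tk]; case: (x.2 =P r) => [<-|_] tr; first by rewrite -x1.
  by apply: IHt => //; rewrite eq_sym.
- rewrite x2 (negPf rk) addn0 => -[tk].
  case: (x.1 =P r) => [<-|_] tr; first by rewrite e_sym -x2.
  by apply: IHt => //; rewrite eq_sym.
- by rewrite /= !add0n => tk; rewrite tk ltnn in le_t.
Qed.

Lemma edges_prod_nseq n (x : 'I_n * 'I_n) q i :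
  edges_prod (nseq q x) i = q * ((x.1 == i) + (x.2 == i)).
Proof.
elim: q => [|q IHq] /=; first by rewrite mnm0E.
by rewrite /edge_mon !mnmDE !mnm1E IHq mulSn.
Qed.

Lemma polymatroid_nonadj_trans n (e : rel 'I_n) q i j k :
  ssrbool.symmetric e -> irreflexive e -> (forall i, exists j, e i j) -> 0 < q ->
  polymatroid (min_gens (in_edge_ideal_pow e q)) ->
  ~~ e i k -> ~~ e k j -> ~~ e i j.
Proof.
move=> e_sym e_irr e_nbr q_gt0 [_ _ exch] eik ekj; apply/negP => eij.
have [l ekl] := e_nbr k.
have gen x : e x.1 x.2 -> min_gens (in_edge_ideal_pow e q) (edges_prod (nseq q x)).
  move=> ex; apply/min_gensP; exists (nseq q x); split=> //; first exact: size_nseq.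
  by move=> y; rewrite mem_nseq => /andP[_ /eqP ->].
have neq a b c : e a c -> ~~ e b c -> (a == b) = false.
  by move=> eac /negP ebc; apply/eqP => ab; rewrite ab in eac.
have kl : (k == l) = false by apply/eqP => kl; rewrite kl e_irr in ekl.
have il : (i == l) = false by rewrite eq_sym; apply: (neq _ _ k); rewrite // e_sym.
have jl : (j == l) = false by rewrite eq_sym; apply: (neq _ _ k); rewrite // e_sym.
have ik : (i == k) = false by apply: neq eij ekj.
have jk : (j == k) = false by apply: (neq _ _ i); rewrite e_sym.
(* The exponent of [l] is [q] in the first power and 0 in the second; the [r] received in exchange
   divides the second, so it is [i] or [j]. *)
have := exch _ _ l (gen (k, l) ekl) (gen (i, j) eij).
rewrite !edges_prod_nseq /= kl il jl eqxx => /(_ ltac:(lia)) [r [lt_r]].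
rewrite !edges_prod_nseq /= in lt_r.
move=> [w [/min_gensP[t [st et <-]]]] /mnm_exchE tE.
have rij : (r == i) || (r == j).
  move: lt_r; rewrite (eq_sym i r) (eq_sym j r).
  by case: (r == i) => //; case: (r == j) => //; rewrite muln0.
have rk : r != k by case/orP: rij => /eqP ->; rewrite ?ik ?jk.
have := tE k; have := tE r.
rewrite !edges_prod_nseq /= !eqxx (eq_sym l k) (eq_sym k r) (negPf rk) kl => tr tk.
have rl : (l == r) = false by case/orP: rij => /eqP ->; rewrite eq_sym ?il ?jl.
(* The exponent of [k] is still [q], so [k] lies in each of the [q] edges, one of which contains
   [r]. *)
have ekr : e k r.
  apply: (edges_prod_neighbour e_sym e_irr et _ rk).
    by rewrite st; move: tk; rewrite !addn0 muln1.
  by move: tr; rewrite rl !addn0 muln0 add0n => ->.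
case/orP: rij ekr => /eqP ->; last by apply/negP.
by rewrite e_sym; apply/negP.
Qed.

(** The parts are the classes of non-adjacency, encoded as the distinct sets of non-neighbours and
    numbered by their rank in [P]. *)
Lemma nonadj_trans_multipartite n (e : rel 'I_n) :
  ssrbool.symmetric e -> irreflexive e -> (forall i, exists j, e i j) -> 0 < n ->
  (forall i j k, ~~ e i k -> ~~ e k j -> ~~ e i j) -> complete_multipartite e.
Proof.
move=> e_sym e_irr e_nbr n_gt0 e_tr.
pose N (i : 'I_n) := [set j | ~~ e i j].
have NE i j : (N i == N j) = ~~ e i j.
  apply/eqP/idP => [Nij|eij].
    by have : j \in N j; [rewrite inE e_irr | rewrite -Nij inE].
  apply/setP => k; rewrite !inE; apply/idP/idP; last exact: e_tr.
  by apply: e_tr; rewrite e_sym.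
pose P := N @: [set: 'I_n].
have NP i : N i \in P by rewrite imset_f.
(* One fixed default for [enum_rank_in], so that [p i] depends on [N i] alone. *)
pose i0 := Ordinal n_gt0.
pose p i := enum_rank_in (NP i0) (N i).
have pE i : enum_val (p i) = N i by rewrite enum_rankK_in.
have eE i j : e i j = (p i != p j).
  rewrite -[e i j]negbK -NE; congr (~~ _).
  by apply/eqP/eqP => [Nij|pij]; rewrite -?pE ?pij // /p Nij.
exists #|P|; split.
  (* A vertex and one of its neighbours lie in different parts, hence at least two parts. *)
  have [j] := e_nbr i0; rewrite eE => pij.
  have := card_ord #|P| => <-; rewrite (cardD1 (p i0)) (cardD1 (p j)) !inE.
  by rewrite eq_sym pij.
exists p; split=> // k.
have /imsetP[i _ Ni] := enum_valP k.
by exists i; apply: enum_val_inj; rewrite pE Ni.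
Qed.

(** * Sums over words, and congruence modulo a generated ideal *)

Lemma ltn_sum_seq_ex (T : eqType) (r : seq T) (F G : T -> nat) :
  \sum_(x <- r) F x < \sum_(x <- r) G x -> exists2 x, x \in r & F x < G x.
Proof.
move=> ltFG; apply/hasP; apply: contraLR ltFG => /hasPn nFG.
by rewrite -leqNgt !big_seq; apply: leq_sum => x /nFG; rewrite -leqNgt.
Qed.

Lemma mnm_exch_sum n (u u' v v' : mon n) a b :
  (u' + U_(a))%MM = (u + U_(b))%MM -> (v' + U_(b))%MM = (v + U_(a))%MM ->
  (u' + v')%MM = (u + v)%MM.
Proof.
move=> uE vE; apply/mnmP => i; rewrite !mnmDE.
by have := mnm_exchE uE i; have := mnm_exchE vE i; lia.
Qed.

Section IdealGen.
Import GRing.Theory.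
Local Open Scope ring_scope.
Variables (R : comNzRingType) (P : R -> Prop).

Lemma ideal_gen0 : in_ideal_gen P 0.
Proof. by exists [::]; rewrite big_nil. Qed.

Lemma ideal_gen_mem f : P f -> in_ideal_gen P f.
Proof.
move=> Pf; exists [:: (1, f)]; rewrite big_seq1 mul1r; split=> // x.
by rewrite inE => /eqP ->.
Qed.

Lemma ideal_genD f g : in_ideal_gen P f -> in_ideal_gen P g -> in_ideal_gen P (f + g).
Proof.
move=> [r [Pr ->]] [r' [Pr' ->]]; exists (r ++ r'); rewrite big_cat; split=> // x.
by rewrite mem_cat => /orP[/Pr|/Pr'].
Qed.

Lemma ideal_genM a f : in_ideal_gen P f -> in_ideal_gen P (a * f).
Proof.
move=> [r [Pr ->]]; exists [seq (a * x.1, x.2) | x <- r]; split.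
  by move=> _ /mapP[x /Pr Px ->].
by rewrite big_map mulr_sumr; apply: eq_bigr => x _; rewrite mulrA.
Qed.

Lemma ideal_gen_sum (I : eqType) (r : seq I) F :
  (forall i, i \in r -> in_ideal_gen P (F i)) -> in_ideal_gen P (\sum_(i <- r) F i).
Proof.
move=> PF; rewrite big_seq.
by elim/big_ind: _ => //; [apply: ideal_gen0 | apply: ideal_genD].
Qed.

Definition congr_ideal f g := in_ideal_gen P (f - g).

Lemma congr_ideal_refl f : congr_ideal f f.
Proof. by rewrite /congr_ideal subrr; apply: ideal_gen0. Qed.

Lemma congr_ideal_sym f g : congr_ideal f g -> congr_ideal g f.
Proof. by move=> /(ideal_genM (-1)); rewrite mulN1r opprB. Qed.

Lemma congr_ideal_trans g f h : congr_ideal f g -> congr_ideal g h -> congr_ideal f h.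
Proof. by move=> fg gh; have := ideal_genD fg gh; rewrite /congr_ideal addrA subrK. Qed.

Lemma congr_idealM a f g : congr_ideal f g -> congr_ideal (a * f) (a * g).
Proof. by move=> /(ideal_genM a); rewrite mulrBr. Qed.

End IdealGen.

(** * The toric ideal of the part-bounded monomials *)

Section ToricIdeal.
Import GRing.Theory.
Local Open Scope ring_scope.
Variables (K : fieldType) (n m q s : nat) (p : 'I_n -> 'I_m).
Variable w : s.-tuple (mon n).
Hypothesis q_gt0 : (0 < q)%N.
Hypothesis w_uniq : uniq w.
Hypothesis wB : forall u, part_bounded p q u <-> u \in w.

Local Notation cong := (congr_ideal (@sym_exch_binomial K n s w)).
(** A sequence of indices is a word: [Xprod] is its monomial in the [z] variables, [wsum] the
    exponent vector of its toric image. *)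
Local Notation Xprod L := (\prod_(i <- L) 'X_i : {mpoly K[s]}).
Local Notation wsum L := (\sum_(i <- L) tnth w i)%MM.

Lemma part_bounded_tnth i : part_bounded p q (tnth w i).
Proof. by apply/wB; apply: mem_tnth. Qed.

Lemma part_bounded_tnth_ex u : part_bounded p q u -> exists i, tnth w i = u.
Proof. by move=> /wB/tnthP[i ->]; exists i. Qed.

Lemma sym_exch_cong i j i' j' xi rho :
  (tnth w j xi < tnth w i xi)%N -> (tnth w i rho < tnth w j rho)%N ->
  (tnth w i' + U_(xi) = tnth w i + U_(rho))%MM ->
  (tnth w j' + U_(rho) = tnth w j + U_(xi))%MM ->
  cong ('X_i * 'X_j) ('X_i' * 'X_j').
Proof. by move=> *; apply: ideal_gen_mem; exists i, j, i', j', xi, rho. Qed.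

(* A move that lowers the imbalance at xi but raises it at rho is the composite
   of a symmetric exchange and of the reverse of one, through a third variable. *)
Lemma unbalanced_exch_cong i j i' j' xi rho : xi != rho ->
  (tnth w j xi + 2 <= tnth w i xi)%N -> (tnth w j rho <= tnth w i rho)%N ->
  (tnth w i' + U_(xi) = tnth w i + U_(rho))%MM ->
  (tnth w j' + U_(rho) = tnth w j + U_(xi))%MM ->
  cong ('X_i * 'X_j) ('X_i' * 'X_j').
Proof.
move=> nxr le_xi le_rho iE jE.
have lt_xi : (tnth w j xi < tnth w i xi)%N by apply: leq_trans le_xi; rewrite addn2.
have [t [lt_t _ [u' [v' [/part_bounded_tnth_ex[a <-] /part_bounded_tnth_ex[b <-] aE bE]]]]] :=
  part_bounded_sym_exch (part_bounded_tnth i) (part_bounded_tnth j) lt_xi.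
have t_xi : (t == xi) = false by apply/eqP => tE; rewrite tE in lt_t; lia.
have t_rho : (t == rho) = false by apply/eqP => tE; rewrite tE in lt_t; lia.
(* The second exchange is read backwards: from [i'], [j'] to [a], [b] it trades [rho] for [t], where
   [i'] now exceeds [j'] at [rho]. *)
apply: (congr_ideal_trans (sym_exch_cong lt_xi lt_t aE bE)).
apply: congr_ideal_sym; apply: (@sym_exch_cong _ _ _ _ rho t).
- have := mnm_exchE iE rho; have := mnm_exchE jE rho.
  by rewrite (negPf nxr) eqxx; lia.
- have := mnm_exchE iE t; have := mnm_exchE jE t.
  by rewrite !(eq_sym _ t) t_xi t_rho; lia.
- apply/mnmP => x; rewrite !(mnmDE, mnm1E).
  by have := mnm_exchE iE x; have := mnm_exchE aE x; lia.
- apply/mnmP => x; rewrite !(mnmDE, mnm1E).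
  by have := mnm_exchE jE x; have := mnm_exchE bE x; lia.
Qed.

(** The move is a symmetric exchange, or its reverse is one (gaps below 2 at both variables), or it
    is unbalanced, possibly with the two factors swapped. *)
Lemma exch_cong i j i' j' xi rho :
  (tnth w i' + U_(xi) = tnth w i + U_(rho))%MM ->
  (tnth w j' + U_(rho) = tnth w j + U_(xi))%MM ->
  cong ('X_i * 'X_j) ('X_i' * 'X_j').
Proof.
move=> iE jE; have w_inj := elimT (tuple_uniqP w) w_uniq.
have [xr|nxr] := eqVneq xi rho.
  rewrite xr in iE jE; have /w_inj -> := addIm iE; have /w_inj -> := addIm jE.
  exact: congr_ideal_refl.
have rx : rho != xi by rewrite eq_sym.
have := mnm_exchE iE xi; have := mnm_exchE iE rho.
have := mnm_exchE jE xi; have := mnm_exchE jE rho.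
rewrite !eqxx (negPf nxr) (negPf rx) => j_rho j_xi i_rho i_xi.
case: (ltnP (tnth w i xi) (tnth w j xi + 2)) => lt_xi.
  case: (ltnP (tnth w j rho) (tnth w i rho + 2)) => lt_rho.
    apply: congr_ideal_sym; rewrite mulrC [X in cong _ X]mulrC.
    by apply: (@sym_exch_cong _ _ _ _ xi rho) => //; lia.
  case: (ltnP (tnth w j xi) (tnth w i xi)) => lt_xi'.
    by apply: (@sym_exch_cong _ _ _ _ xi rho) => //; lia.
  rewrite mulrC [X in cong _ X]mulrC.
  by apply: (@unbalanced_exch_cong _ _ _ _ rho xi).
case: (ltnP (tnth w i rho) (tnth w j rho)) => lt_rho.
  by apply: (@sym_exch_cong _ _ _ _ xi rho) => //; lia.
by apply: (@unbalanced_exch_cong _ _ _ _ xi rho).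
Qed.

(** Finds, after rewriting the word, a letter able to trade [rho] for [xi]. In distinct parts it
    must contain [rho] and have room in the part of [xi]; if a letter [v1] with room lacks [rho], an
    exchange with a letter [v2] containing [rho] brings it in. *)
Lemma exch_partner L xi rho :
  (0 < wsum L rho)%N -> p rho = p xi \/ (psum p (wsum L) (p xi) < q * size L)%N ->
  exists v v' L', [/\ (size L').+1 = size L, wsum (v :: L') = wsum L,
    cong (Xprod L) (Xprod (v :: L')) & (tnth w v' + U_(rho) = tnth w v + U_(xi))%MM].
Proof.
move=> L_rho ok.
have take_partner v : v \in L -> (0 < tnth w v rho)%N ->
    p rho = p xi \/ (psum p (tnth w v) (p xi) < q)%N ->
  exists v v' L', [/\ (size L').+1 = size L, wsum (v :: L') = wsum L,
    cong (Xprod L) (Xprod (v :: L')) & (tnth w v' + U_(rho) = tnth w v + U_(xi))%MM].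
  move=> vL v_rho v_ok; have perm_L := perm_to_rem vL.
  have [u uE] := mnm_exch_ex xi v_rho.
  have [v' v'E] : exists v', tnth w v' = u.
    apply: part_bounded_tnth_ex.
    by apply: part_bounded_exch (part_bounded_tnth v) uE _; case: v_ok; [left|right].
  exists v, v', (rem v L); split; rewrite ?v'E //.
  - by rewrite (perm_size perm_L).
  - by rewrite (perm_big _ perm_L).
  - by rewrite (perm_big _ perm_L); apply: congr_ideal_refl.
have [v2 v2L v2_rho] : exists2 v, v \in L & (0 < tnth w v rho)%N.
  by apply: ltn_sum_seq_ex; rewrite big1 // -mnm_sumE.
have [same|diff] := eqVneq (p rho) (p xi).
  by apply: (take_partner v2) => //; left.
case: ok => [/eqP|lt_L]; first by rewrite (negPf diff).
(* By averaging, some letter is below [q] in the part of [xi]. *)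
have [v1 v1L v1_xi] : exists2 v, v \in L & (psum p (tnth w v) (p xi) < q)%N.
  apply: ltn_sum_seq_ex; rewrite big_const_seq count_predT iter_addn_0.
  apply: leq_ltn_trans lt_L; rewrite leq_eqVlt; apply/orP; left; apply/eqP.
  by rewrite exchange_big /=; apply: eq_bigr => x _; rewrite mnm_sumE.
case: (posnP (tnth w v1 rho)) => [v1_rho|v1_rho]; last first.
  by apply: (take_partner v1) => //; right.
have v21 : (tnth w v1 rho < tnth w v2 rho)%N by rewrite v1_rho.
have [t [lt_t _ [u' [u [/part_bounded_tnth_ex[a <-] /part_bounded_tnth_ex[b <-] aE bE]]]]] :=
  part_bounded_sym_exch (part_bounded_tnth v2) (part_bounded_tnth v1) v21.
have t_rho : (t == rho) = false by apply/eqP => tE; rewrite tE in lt_t; lia.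
have b_rho : (0 < tnth w b rho)%N.
  by have := mnm_exchE bE rho; rewrite eqxx t_rho; lia.
(* The gained [rho] is outside the part of [xi], so the room there is kept. *)
have b_xi : (psum p (tnth w b) (p xi) < q)%N.
  by have := psum_exch p (p xi) bE; rewrite (negPf diff); lia.
have [v v'E] := mnm_exch_ex xi b_rho.
have [v' v'v] : exists v', tnth w v' = v.
  apply: part_bounded_tnth_ex.
  by apply: part_bounded_exch (part_bounded_tnth b) v'E _; right.
have v2L' : v2 \in rem v1 L.
  have := perm_mem (perm_to_rem v1L) v2; rewrite v2L inE => /esym/predU1P[v2v1|//].
  by rewrite v2v1 ltnn in v21.
have perm_L : perm_eq L (v1 :: v2 :: rem v2 (rem v1 L)).
  by rewrite (perm_trans (perm_to_rem v1L)) // perm_cons perm_to_rem.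
exists b, v', (a :: rem v2 (rem v1 L)); split; rewrite ?v'v //.
- by rewrite (perm_size perm_L).
- rewrite (perm_big _ perm_L) /= !big_cons !addmA; congr (_ + _)%MM.
  exact: mnm_exch_sum bE aE.
- rewrite (perm_big _ perm_L) /= !big_cons !mulrA -!(mulrC (Xprod (rem v2 (rem v1 L)))).
  by apply: congr_idealM; apply: exch_cong bE aE.
Qed.

(* Exchanges between the head and the tail move the head i towards j; the bound
   on the part sums of T makes some tail element able to absorb each exchange. *)
Lemma cong_to_head i j L :
  let T := (tnth w i + wsum L)%MM in
  (tnth w j <= T)%MM ->
  (forall k, psum p T k <= psum p (tnth w j) k + q * size L)%N ->
  exists L', [/\ size L' = size L, (tnth w j + wsum L' = T)%MM &
                 cong ('X_i * Xprod L) ('X_j * Xprod L')].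
Proof.
(* Induction on the total excess of the head over its target [tnth w j]. *)
have [d] := ubnP (\sum_x (tnth w i x - tnth w j x))%N.
elim: d => // d IHd in i L *; rewrite ltnS => le_d T jT psumT.
have [di _] := part_boundedP p q _ (part_bounded_tnth i).
have [dj _] := part_boundedP p q _ (part_bounded_tnth j).
case: (boolP [exists x, tnth w j x < tnth w i x]%N) => [/existsP[xi lt_xi]|]; last first.
  move=> /existsPn le_ij.
  have /(elimT (tuple_uniqP w) w_uniq) ij : tnth w i = tnth w j.
    apply: lem_mdeg_eq; last by rewrite di dj.
    by apply/mnm_lepP => x; rewrite leqNgt.
  by rewrite /T ij; exists L; split=> //; apply: congr_ideal_refl.
have [rho [lt_rho ok [u [_ [/part_bounded_tnth_ex[i' <-] _ i'E _]]]]] :=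
  part_bounded_sym_exch (part_bounded_tnth i) (part_bounded_tnth j) lt_xi.
have L_rho : (0 < wsum L rho)%N.
  by have /mnm_lepP/(_ rho) := jT; rewrite mnmDE; lia.
(* If the head exceeds the target in the part of [xi], the bound on [T] leaves room in the tail. *)
have L_ok : p rho = p xi \/ (psum p (wsum L) (p xi) < q * size L)%N.
  case: ok => [|[lt _]]; [by left | right].
  by have := psumT (p xi); rewrite psumD; lia.
have [v [v' [L1 [szL1 sumL1 congL1 v'E]]]] := exch_partner L_rho L_ok.
have TE : (tnth w i' + wsum (v' :: L1))%MM = T.
  by rewrite /T -sumL1 !big_cons !addmA (mnm_exch_sum i'E v'E).
have lt_d : (\sum_x (tnth w i' x - tnth w j x) < d)%N.
  apply: leq_trans le_d; have E := mnm_exchE i'E.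
  rewrite (bigD1 xi) //= [ltnRHS](bigD1 xi) //= -addSn leq_add //.
    have := E xi; rewrite eqxx; case: (rho =P xi) => [rx|_]; last by lia.
    by rewrite rx in lt_rho; lia.
  apply: leq_sum => x; rewrite eq_sym => /negPf x_xi; have := E x; rewrite x_xi.
  by case: (rho =P x) => [<-|_]; lia.
have [||L' [szL' sumL' congL']] := IHd i' (v' :: L1) lt_d.
- by rewrite TE.
- by move=> k; rewrite TE /= szL1.
exists L'; split; rewrite ?szL' //; first by rewrite sumL' TE.
apply: congr_ideal_trans congL'; apply: congr_ideal_trans (congr_idealM _ congL1) _.
rewrite !big_cons !mulrA -!(mulrC (Xprod L1)); apply: congr_idealM.
exact: exch_cong i'E v'E.
Qed.

Lemma psum_wsum L k : (psum p (wsum L) k <= q * size L)%N.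
Proof.
elim: L => [|i L IHL].
  by rewrite big_nil /psum big1 // => x _; rewrite mnm0E.
rewrite big_cons psumD /= mulnS leq_add //.
by have [_ ->] := part_boundedP p q _ (part_bounded_tnth i).
Qed.

Lemma mdeg_wsum L : mdeg (wsum L) = (q.*2 * size L)%N.
Proof.
elim: L => [|i L IHL]; first by rewrite big_nil mdeg0 muln0.
by rewrite big_cons mdegD IHL /= mulnS; have [-> _] := part_boundedP p q _ (part_bounded_tnth i).
Qed.

(** Each letter has degree [q.*2 > 0], so both words have the same length; the tail of [L2] then
    gives the bound on part sums that [cong_to_head] requires. *)
Lemma wsum_cong L1 L2 : wsum L1 = wsum L2 -> cong (Xprod L1) (Xprod L2).
Proof.
elim: L2 L1 => [|j L2 IHL] [|i L1] sumE; first exact: congr_ideal_refl.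
- by have /eqP := congr1 (@mdeg n) sumE; rewrite !mdeg_wsum /= muln0 muln_eq0; lia.
- by have /eqP := congr1 (@mdeg n) sumE; rewrite !mdeg_wsum /= muln0 eq_sym muln_eq0; lia.
have sz : size L1 = size L2.
  have /eqP := congr1 (@mdeg n) sumE.
  by rewrite !mdeg_wsum eqn_pmul2l ?double_gt0 //= => /eqP[].
rewrite !big_cons in sumE *.
have [||L [_ sumL congL]] := @cong_to_head i j L1.
- by rewrite sumE lem_addr.
- by move=> k; rewrite sumE psumD leq_add2l sz psum_wsum.
apply: congr_ideal_trans congL _; apply: congr_idealM; apply: IHL.
by apply: (@addmI _ (tnth w j)); rewrite sumL.
Qed.

Definition mnm_word (u : 'X_{1..s}) : seq 'I_s :=
  flatten [seq nseq (u i) i | i <- enum 'I_s].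

Lemma prod_mnm_word u : Xprod (mnm_word u) = 'X_[u].
Proof.
rewrite big_flatten big_map big_enum mpolyXE_id /=.
by apply: eq_bigr => i _; rewrite big_nseq iter_mulr_1.
Qed.

Lemma toric_map_prod L : toric_map w (Xprod L) = 'X_[wsum L] :> {mpoly K[n]}.
Proof.
rewrite /toric_map rmorph_prod /=.
elim: L => [|i L IHL]; first by rewrite !big_nil mpolyX0.
by rewrite !big_cons IHL mpolyXD comp_mpolyXU -tnth_nth tnth_mktuple.
Qed.

Lemma sym_exch_toric f : sym_exch_binomial w f -> toric_map w f = 0 :> {mpoly K[n]}.
Proof.
move=> [i [j [i' [j' [xi [rho [_ _ iE jE ->]]]]]]].
have XE a b : 'X_a * 'X_b = Xprod [:: a; b] by rewrite big_cons big_seq1.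
rewrite /toric_map rmorphB /= -!/(toric_map w _) !XE !toric_map_prod !big_cons !big_nil.
by rewrite !addmA (mnm_exch_sum iE jE) subrr.
Qed.

(** Replacing each monomial of [f] by a representative with the same image changes [f] by an element
    of the ideal, and the result vanishes because the coefficients over each image sum to zero. *)
Lemma toric_generated : toric_generated_by_sym_exch K w.
Proof.
move=> f; split=> [f0|[r [rP ->]]]; last first.
  rewrite /toric_map rmorph_sum big_seq big1 // => x /rP /sym_exch_toric x0.
  by rewrite rmorphM /=; rewrite /toric_map in x0; rewrite x0 mulr0.
pose phi u := wsum (mnm_word u).
(* When [M] is the image of a support monomial, the filtered list is nonempty and [rep M] has image
   [M]. *)
pose rep M := head 0%MM [seq u <- msupp f | phi u == M].
have phi_rep u : u \in msupp f -> phi (rep (phi u)) = phi u.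
  move=> uf; suff : rep (phi u) \in [seq v <- msupp f | phi v == phi u].
    by rewrite mem_filter => /andP[/eqP].
  have : u \in [seq v <- msupp f | phi v == phi u] by rewrite mem_filter eqxx.
  by rewrite /rep; case: [seq _ <- _ | _] => //= *; apply: mem_head.
have toricE : \sum_(u <- msupp f) f@_u *: 'X_[phi u] = 0 :> {mpoly K[n]}.
  rewrite -[RHS]f0 [in RHS](mpolyE f) /toric_map raddf_sum /=.
  apply: eq_bigr => u _; rewrite linearZ /= -prod_mnm_word; congr (_ *: _).
  by rewrite -toric_map_prod.
have rep0 : \sum_(u <- msupp f) f@_u *: 'X_[rep (phi u)] = 0 :> {mpoly K[s]}.
  pose r := undup [seq phi u | u <- msupp f].
  (* The terms are grouped by image: the coefficient of [rep M] is that of [M] in the toric image of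
     [f]. *)
  transitivity (\sum_(M <- r) (\sum_(u <- msupp f) f@_u *: 'X_[K, phi u])@_M *: 'X_[K, rep M]).
    under [RHS]eq_bigr do rewrite raddf_sum scaler_suml.
    rewrite exchange_big /= !big_seq; apply: eq_bigr => u uf.
    have ur : phi u \in r by rewrite mem_undup map_f.
    rewrite (bigD1_seq (phi u)) ?undup_uniq //= mcoeffZ mcoeffX eqxx mulr1.
    rewrite big1 ?addr0 // => M nM.
    by rewrite mcoeffZ mcoeffX eq_sym (negPf nM) mulr0 scale0r.
  by rewrite toricE big1 // => M _; rewrite mcoeff0 scale0r.
rewrite -[f]subr0 -rep0 {1}(mpolyE f) -sumrB.
apply: ideal_gen_sum => u uf; rewrite -scalerBr -mul_mpolyC; apply: ideal_genM.
by rewrite -!prod_mnm_word; apply: wsum_cong; rewrite -!/(phi _) phi_rep.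
Qed.

End ToricIdeal.

(** * Equivalence of the three conditions, and generation of the toric ideal *)

Theorem theorem3p1 (n : nat) (e : rel 'I_n)
  (e_sym : ssrbool.symmetric e) (e_irr : irreflexive e)
  (no_isolated : forall i : 'I_n, exists j, e i j) (n_pos : (0 < n)%N) :
  [/\ (exists q, (0 < q)%N /\ polymatroid (min_gens (in_edge_ideal_pow e q)))
        <-> (forall q, (0 < q)%N -> polymatroid (min_gens (in_edge_ideal_pow e q))),
      (forall q, (0 < q)%N -> polymatroid (min_gens (in_edge_ideal_pow e q)))
        <-> complete_multipartite e
    & complete_multipartite e ->
      forall (K : fieldType) (q s : nat) (w : s.-tuple (mon n)),
        (0 < q)%N -> uniq w ->
        (forall u, min_gens (in_edge_ideal_pow e q) u <-> u \in w) ->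
        toric_generated_by_sym_exch K w].
Proof.
have multi_poly : complete_multipartite e ->
    forall q, (0 < q)%N -> polymatroid (min_gens (in_edge_ideal_pow e q)).
  by move=> [m [_ [p [_ eE]]]] q _; apply: polymatroid_multipartite eE.
have poly_multi : (exists q, (0 < q)%N /\ polymatroid (min_gens (in_edge_ideal_pow e q))) ->
    complete_multipartite e.
  move=> [q [q_gt0 poly]]; apply: nonadj_trans_multipartite => // i j k.
  exact: polymatroid_nonadj_trans q_gt0 poly.
split.
- by split=> [/poly_multi/multi_poly //|all_poly]; exists 1; split; [|apply: all_poly].
- by split=> // all_poly; apply: poly_multi; exists 1; split; [|apply: all_poly].
move=> [m [_ [p [_ eE]]]] K q s w q_gt0 w_uniq wB.
have wB' u : part_bounded p q u <-> u \in w.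
  by rewrite -wB; apply: iff_sym; apply: min_gens_multipartite.
exact: toric_generated wB'.
Qed.
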